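(* Let $\lambda=(\lambda_1,\ldots,\lambda_\ell)$ be a partition with $\ell\ge 2$ parts such that $\lambda_1>\lambda_2$ and $\lambda_\ell=1$. Then the average, over all right-justified standard tableaux $t$ of shape $\lambda$, of the number of braid hooks of $t$ equals $1$.
   Context: The right-justified diagram of a partition $\lambda=(\lambda_1\ge\cdots\ge\lambda_\ell\ge1)$ consists of cells $(r,c)$ with $1\le r\le \ell$ and $\lambda_1-\lambda_r+1\le c\le \lambda_1$ (row $r$ top to bottom, column $c$ left to right; rows are aligned on the right). A right-justified standard tableau of shape $\lambda$ is a bijective filling of these cells with $1,\ldots,|\lambda|$ increasing along rows from left to right and along columns from top to bottom; the set of these is ${\sf rSYT}(\lambda)$. An integer $k$ is a braid hook of $t$ if there is a cell $(r,c)$ with $k-1$ in $(r,c)$, $k$ in $(r,c+1)$, $k+1$ in $(r+1,c+1)$, and $(r+1,c)$ not a cell of the diagram. *)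

(* Defs.v *)
From mathcomp Require Import all_boot.

Set Implicit Arguments.
Unset Strict Implicit.
Unset Printing Implicit Defensive.

Definition is_partition (la : seq nat) : bool :=
  sorted geq la && all (fun p => 0 < p) la.

(* Rows and columns are numbered from 0, so that the 1-based condition
   la_1 - la_r + 1 <= c <= la_1 becomes la_1 - la_r <= c < la_1. *)
Definition in_diagram (la : seq nat) (r c : nat) : bool :=
  (r < size la) && (nth 0 la 0 - nth 0 la r <= c < nth 0 la 0).

Definition cell (la : seq nat) : finType :=
  {p : 'I_(size la) * 'I_(nth 0 la 0) | in_diagram la p.1 p.2}.

Definition cell_row (la : seq nat) (x : cell la) : nat := (sval x).1.
Definition cell_col (la : seq nat) (x : cell la) : nat := (sval x).2.

Definition filling (la : seq nat) : finType := {ffun cell la -> 'I_(sumn la)}.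

(* The ordinal i stands for the entry i + 1, so entries range over
   1, ..., |la|. *)
Definition entry (la : seq nat) (t : filling la) (x : cell la) : nat :=
  (t x).+1.

Definition rSYT (la : seq nat) : {set filling la} :=
  [set t : filling la |
    [&& injectiveb t,
        [forall k : 'I_(sumn la), exists x : cell la, t x == k],
        [forall x : cell la, forall y : cell la,
           (cell_row x == cell_row y) && (cell_col x < cell_col y) ==> (entry t x < entry t y)]
      & [forall x : cell la, forall y : cell la,
           (cell_col x == cell_col y) && (cell_row x < cell_row y) ==> (entry t x < entry t y)]]].

(* x, y, z are the cells (r,c), (r,c+1), (r+1,c+1). *)
Definition braid_hook (la : seq nat) (t : filling la) (k : nat) : bool :=
  [exists x : cell la, exists y : cell la, exists z : cell la,
    [&& (cell_row y == cell_row x) && (cell_col y == (cell_col x).+1),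
        (cell_row z == (cell_row x).+1) && (cell_col z == (cell_col x).+1),
        ~~ in_diagram la (cell_row x).+1 (cell_col x),
        (entry t x).+1 == k, entry t y == k & entry t z == k.+1]].

(* A braid hook of t is an entry of t, so k only needs to range over
   1, ..., |la|. *)
Definition num_braid_hooks (la : seq nat) (t : filling la) : nat :=
  count (braid_hook t) (iota 1 (sumn la)).

(* Main.v *)
(* For a tableau t let s_k(t) be +1 if the entries k, k+1 are vertically adjacent,
   -1 if they are horizontally adjacent and 0 if their cells are incomparable.
   Summed over all tableaux, s_{k+1} - s_k only sees the tableaux in which
   k, k+1, k+2 form a chain: the other configurations of three consecutive entries
   cancel under swapping consecutive incomparable entries. On a chain the
   difference is 2 at a braid hook and 0 otherwise, because the diagram lacks no
   upper right corners. Summing over k telescopes, and s_1 = -1 (as la_1 > la_2)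
   while s_{n-1} = +1 (as the last part is 1), so there are as many braid hooks
   as tableaux. *)
Require Import Defs.
From mathcomp Require Import all_boot all_order all_algebra.
From mathcomp Require Import perm zify.

Set Implicit Arguments.
Unset Strict Implicit.
Unset Printing Implicit Defensive.

Import GRing.Theory Num.Theory.

(** * Cells of the diagram, tableaux and the braid hook count *)

Lemma partition_nth (la : seq nat) i j :
  is_partition la -> i <= j -> j < size la -> 0 < nth 0 la j <= nth 0 la i.
Proof.
case/andP=> la_sort la_pos ij jl; apply/andP; split.
  by move/allP: la_pos; apply; apply: mem_nth.
have geq_trans : transitive geq by move=> a b c /= ba ac; apply: leq_trans ac ba.
move: ij; rewrite leq_eqVlt => /orP[/eqP-> //|ij].
by apply: (sorted_ltn_nth geq_trans 0 la_sort) => //; rewrite inE; lia.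
Qed.

Section Cells.
Variable la : seq nat.

Lemma cellP (x : cell la) : in_diagram la (cell_row x) (cell_col x).
Proof. exact: (svalP x). Qed.

Lemma cell_ex r c : in_diagram la r c ->
  exists x : cell la, cell_row x = r /\ cell_col x = c.
Proof.
move=> rc; have [rl cl] : r < size la /\ c < nth 0 la 0.
  by move: rc; rewrite /in_diagram; lia.
by exists (exist (fun p : 'I__ * 'I__ => in_diagram la p.1 p.2)
  (Ordinal rl, Ordinal cl) rc).
Qed.

Lemma cell_eq (x y : cell la) :
  cell_row x = cell_row y -> cell_col x = cell_col y -> x = y.
Proof.
move=> er ec; apply: val_inj; case: x y er ec => [[a b] p] [[c d] q].
by rewrite /cell_row /cell_col /= => /val_inj-> /val_inj->.
Qed.

Lemma card_cell : is_partition la -> #|cell la| = sumn la.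
Proof.
move=> la_part; rewrite card_sig -sum1_card.
rewrite -(pair_big_dep xpredT (fun (i : 'I_(size la)) (j : 'I_(nth 0 la 0)) =>
  in_diagram la i j) (fun _ _ => 1)) /=.
rewrite sumnE (big_nth 0) big_mkord; apply: eq_bigr => i _.
have /andP[_ le_i] := partition_nth la_part (leq0n i) (ltn_ord i).
rewrite /in_diagram ltn_ord /= -(big_mkord
  (fun j => nth 0 la 0 - nth 0 la i <= j < nth 0 la 0) (fun=> 1)).
rewrite (big_cat_nat (n := nth 0 la 0 - nth 0 la i)) ?leq_subr //=.
rewrite big_nat_cond big_pred0 ?add0n; last by move=> j; lia.
rewrite big_nat_cond (eq_bigl (fun j =>
  (nth 0 la 0 - nth 0 la i <= j < nth 0 la 0) && true)); last by move=> j; lia.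
by rewrite -big_nat_cond sum_nat_const_nat; lia.
Qed.

Lemma rSYTP (t : filling la) : t \in rSYT la ->
  [/\ injective t, (forall k : 'I_(sumn la), exists x, t x = k),
      (forall x y, cell_row x = cell_row y -> cell_col x < cell_col y -> t x < t y)
    & (forall x y, cell_col x = cell_col y -> cell_row x < cell_row y -> t x < t y)].
Proof.
rewrite inE => /and4P[/injectiveP t_inj /forallP t_surj /forallP t_row /forallP t_col].
split=> // [k|x y e l|x y e l].
- by have /existsP[x /eqP] := t_surj k; exists x.
- by have /forallP/(_ y) := t_row x; rewrite e eqxx l.
- by have /forallP/(_ y) := t_col x; rewrite e eqxx l.
Qed.

Lemma rSYT_mem (t : filling la) :
  injective t -> (forall k : 'I_(sumn la), exists x, t x = k) ->
  (forall x y, cell_row x = cell_row y -> cell_col x < cell_col y -> t x < t y) ->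
  (forall x y, cell_col x = cell_col y -> cell_row x < cell_row y -> t x < t y) ->
  t \in rSYT la.
Proof.
move=> t_inj t_surj t_row t_col; rewrite inE; apply/and4P; split.
- exact/injectiveP.
- by apply/forallP=> k; have [x /eqP] := t_surj k; move=> ?; apply/existsP; exists x.
- by apply/forallP=> x; apply/forallP=> y; apply/implyP=> /andP[/eqP e l]; apply: t_row.
- by apply/forallP=> x; apply/forallP=> y; apply/implyP=> /andP[/eqP e l]; apply: t_col.
Qed.

(** Numbering the cells row by row, by their rank in the order [lex], gives a tableau. The average
    thus has a nonzero denominator. *)
Lemma rSYT_neq0 : is_partition la -> 0 < #|rSYT la|.
Proof.
move=> la_part; have card_la := card_cell la_part.
pose lex (y x : cell la) := (cell_row y < cell_row x) ||
  (cell_row y == cell_row x) && (cell_col y < cell_col x).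
have lexE x : ~~ lex x x by rewrite /lex; lia.
have rank_lt x : #|[set y | lex y x]| < sumn la.
  rewrite -card_la -cardsT; apply: proper_card; apply/properP.
  by split; [apply: subsetT | exists x; rewrite ?inE ?lexE].
pose t : filling la := [ffun x => Ordinal (rank_lt x)].
have t_lex x y : lex x y -> t x < t y.
  move=> xy; rewrite !ffunE /=; apply: proper_card; apply/properP; split.
    by apply/subsetP=> u; rewrite !inE; move: xy; rewrite /lex; lia.
  by exists x; rewrite inE.
have t_inj : injective t.
  move=> x y e; case: (boolP (lex x y)) => [/t_lex|nxy]; first by rewrite e ltnn.
  case: (boolP (lex y x)) => [/t_lex|nyx]; first by rewrite e ltnn.
  by apply: cell_eq; move: nxy nyx; rewrite /lex; lia.
apply/card_gt0P; exists t; apply: rSYT_mem => // [k|x y e l|x y e l].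
- have /(inj_card_onto t_inj)/(_ k)/codomP[x ->] : #|'I_(sumn la)| <= #|cell la|.
    by rewrite card_ord card_la.
  by exists x.
- by apply: t_lex; rewrite /lex; lia.
- by apply: t_lex; rewrite /lex; lia.
Qed.

(** A braid hook is the middle one of three consecutive entries, so neither 1 nor the largest entry
    can be one. The index [m] is the 0-based value in the first cell of the hook. *)
Lemma num_braid_hooksE (t : filling la) n : sumn la = n.+2 ->
  num_braid_hooks t = (\sum_(0 <= m < n) braid_hook t m.+2)%N.
Proof.
move=> la_n; rewrite /num_braid_hooks la_n -sum1_count.
have -> : iota 1 n.+2 = index_iota 1 n.+3 by rewrite /index_iota subn1.
rewrite big_mkcond big_add1 big_nat_recl //= big_nat_recr //=.
have -> : braid_hook t 1 = false.
  by apply/existsP=> -[x /existsP[y /existsP[z]]]; rewrite /entry; lia.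
have -> : braid_hook t n.+2 = false.
  apply/existsP=> -[x /existsP[y /existsP[z]]]; have := ltn_ord (t z); rewrite /entry; lia.
by rewrite addn0; apply: eq_bigr => m _; case: (braid_hook _ _).
Qed.

(* On cells with consecutive entries, [adj] is the sign of the vertical (+1) or
   horizontal (-1) cover between them, and vanishes iff they are incomparable. *)
Definition adj (x y : cell la) : int :=
  if (cell_col x == cell_col y) &&
     ((cell_row x == (cell_row y).+1) || (cell_row y == (cell_row x).+1)) then 1%R
  else if (cell_row x == cell_row y) &&
     ((cell_col x == (cell_col y).+1) || (cell_col y == (cell_col x).+1)) then (- 1)%R
  else 0%R.

Lemma adjC x y : adj x y = adj y x.
Proof.
by rewrite /adj; repeat case: ifP => ?; lia.
Qed.

(** * Exchange of two consecutive values *)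

Definition swap (i j : 'I_(sumn la)) (t : filling la) : filling la :=
  [ffun x => tperm i j (t x)].

Lemma swapK i j : involutive (swap i j).
Proof. by move=> t; apply/ffunP=> x; rewrite !ffunE tpermK. Qed.

(** No value lies strictly between [i] and [j], so only the comparison of these two with each other
    is reversed. *)
Lemma tperm_succ_mono n (i j a b : 'I_n) : val j = i.+1 -> a < b ->
  (a = i -> b = j -> False) -> tperm i j a < tperm i j b.
Proof.
move=> ij ab nab.
have valE (c : 'I_n) : nat_of_ord (tperm i j c) =
    if val c == i then nat_of_ord j else if val c == j then nat_of_ord i else c.
  by rewrite !val_eqE; case: tpermP =>
    [->|->|/eqP/negbTE-> /eqP/negbTE-> //]; rewrite eqxx //; case: eqP => [->|].
have {}nab : nat_of_ord a = i -> nat_of_ord b = j -> False.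
  by move=> ea eb; apply: nab; apply: val_inj.
by rewrite !valE; move: ij => /= ij; repeat case: ifP => ?; lia.
Qed.

(** * Signs along three consecutive entries *)

Section Tableaux.
Implicit Types (t : filling la) (x y z : cell la).

(** The path from [x] to [y] goes right, then down. Its corner, in the row of [x] and the column of
    [y], is a cell because rows are aligned on the right. *)
Lemma rSYT_lt t x y : t \in rSYT la ->
  cell_row x <= cell_row y -> cell_col x <= cell_col y -> x <> y -> t x < t y.
Proof.
move=> /rSYTP[_ _ t_row t_col] rxy cxy nxy.
have [e|ne] := eqVneq (cell_row x) (cell_row y).
  apply: t_row => //.
  by case: (ltngtP (cell_col x) (cell_col y)) cxy => // e' _;
    case: nxy; apply: cell_eq.
have [u [ru cu]] : exists u : cell la,
    cell_row u = cell_row x /\ cell_col u = cell_col y.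
  by apply: cell_ex; move: (cellP x) (cellP y); rewrite /in_diagram; lia.
have uy : t u < t y by apply: t_col => //; lia.
have [e|ne'] := eqVneq (cell_col x) (cell_col y).
  by have -> : x = u by apply: cell_eq; lia.
by apply: ltn_trans uy; apply: t_row => //; lia.
Qed.

Lemma rSYT_ex t k : t \in rSYT la -> k < sumn la -> exists x, t x = k :> nat.
Proof.
move=> tS lt_k; have [_ t_surj _ _] := rSYTP tS.
by have [x tx] := t_surj (Ordinal lt_k); exists x; rewrite tx.
Qed.

(** Values are 0-based: the three cells hold the entries [m.+1], [m.+2], [m.+3]. *)
Definition triple (m : nat) x y z : {set filling la} :=
  [set t in rSYT la | [&& t x == m :> nat, t y == m.+1 :> nat
     & t z == m.+2 :> nat]].

Lemma tripleP m x y z t : reflect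
  [/\ t \in rSYT la, t x = m :> nat, t y = m.+1 :> nat & t z = m.+2 :> nat]
  (t \in triple m x y z).
Proof.
rewrite [t \in triple _ _ _ _]in_set; apply: (iffP andP) =>
  [[tS /and3P[/eqP tx /eqP ty /eqP tz]]|[tS -> -> ->]] //.
by rewrite !eqxx.
Qed.

Lemma triple_neq m x y z t : t \in triple m x y z -> [/\ x <> y, x <> z & y <> z].
Proof.
by case/tripleP=> _ tx ty tz; split=> e; subst; lia.
Qed.

(** The part of [braid_hook] that depends on the cells only. *)
Definition hook x y z : bool :=
  [&& (cell_row y == cell_row x) && (cell_col y == (cell_col x).+1),
      (cell_row z == (cell_row x).+1) && (cell_col z == (cell_col x).+1)
    & ~~ in_diagram la (cell_row x).+1 (cell_col x)].

(** While [adj] is symmetric, the increase of [t] excludes that [y] lies above or to the left of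
    [x]. *)
Lemma adj_covers t x y : t \in rSYT la -> t x < t y -> adj x y != 0%R ->
  (adj x y = 1%R /\ cell_col y = cell_col x /\ cell_row y = (cell_row x).+1) \/
  (adj x y = (-1)%R /\ cell_row y = cell_row x /\ cell_col y = (cell_col x).+1).
Proof.
move=> tS txy; have [_ _ t_row t_col] := rSYTP tS.
rewrite /adj; case: ifP => [c|_]; [|case: ifP => [c|//]] => _.
- left; have := t_col y x; lia.
- right; have := t_row y x; lia.
Qed.

Local Open Scope ring_scope.

(** Two covers in the same direction cancel. When the direction changes, the fourth corner of the
    square, if it were a cell, would hold a value strictly between those of [x] and [z], which only
    [y] does. Down then right is impossible, as the upper right corner is always a cell; right then
    down forces the lower left corner to be missing, which makes a hook. *)
Lemma adj_chain m x y z t : t \in triple m x y z -> adj x y != 0 -> adj y z != 0 ->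
  adj y z - adj x y = 2 * (hook x y z)%:R.
Proof.
case/tripleP=> tS tx ty tz xy yz.
have txy : (t x < t y)%N by lia.
have tyz : (t y < t z)%N by lia.
have no_between w : (t x < t w)%N -> (t w < t z)%N -> w = y.
  have [t_inj _ _ _] := rSYTP tS.
  by move=> xw wz; apply/t_inj/ord_inj; lia.
have [_ _ t_row t_col] := rSYTP tS.
have [[-> [c1 r1]]|[-> [r1 c1]]] := adj_covers tS txy xy;
have [[-> [c2 r2]]|[-> [r2 c2]]] := adj_covers tS tyz yz.
- by have /negbTE-> : ~~ hook x y z by rewrite /hook; lia.
- have [w [rw cw]] : exists w : cell la, cell_row w = cell_row x /\ cell_col w = cell_col z.
    by apply: cell_ex; move: (cellP x) (cellP z); rewrite /in_diagram; lia.
  have /no_between : (t x < t w)%N by apply: t_row; lia.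
  have /[swap]/[apply] : (t w < t z)%N by apply: t_col; lia.
  by move=> e; subst w; lia.
- suff -> : hook x y z by [].
  rewrite /hook r1 c1 r2 c2 r1 c1 !eqxx /=; apply/negP => /cell_ex[w [rw cw]].
  have /no_between : (t x < t w)%N by apply: t_col; lia.
  have /[swap]/[apply] : (t w < t z)%N by apply: t_row; lia.
  by move=> e; subst w; lia.
- by have /negbTE-> : ~~ hook x y z by rewrite /hook; lia.
Qed.

(** Distinct cells covered by [z] are the one above it and the one to its left, of opposite
    signs. *)
Lemma adj_lower m x y z t : t \in triple m x y z -> adj x z != 0 -> adj y z != 0 ->
  adj y z = - adj x z.
Proof.
move=> /[dup] /triple_neq[nxy _ _] /tripleP[tS tx ty tz] xz yz.
have txz : (t x < t z)%N by lia.
have tyz : (t y < t z)%N by lia.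
have [[-> [c1 r1]]|[-> [r1 c1]]] := adj_covers tS txz xz;
have [[-> [c2 r2]]|[-> [r2 c2]]] := adj_covers tS tyz yz => //;
by case: nxy; apply: cell_eq; lia.
Qed.

Lemma adj_upper m x y z t : t \in triple m x y z -> adj x z != 0 -> adj x y != 0 ->
  adj x y = - adj x z.
Proof.
move=> /[dup] /triple_neq[_ _ nyz] /tripleP[tS tx ty tz] xz xy.
have txz : (t x < t z)%N by lia.
have txy : (t x < t y)%N by lia.
have [[-> [c1 r1]]|[-> [r1 c1]]] := adj_covers tS txz xz;
have [[-> [c2 r2]]|[-> [r2 c2]]] := adj_covers tS txy xy => //;
by case: nyz; apply: cell_eq; lia.
Qed.

Lemma hook_adj x y z : hook x y z -> adj x y = -1 /\ adj y z = 1.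
Proof. by case/and3P=> r c _; rewrite /adj; split; repeat case: ifP => ?; lia. Qed.

(** * Sums over cells against sums over tableaux *)

Lemma sum_unique (I : finType) (F : I -> int) (P : pred I) i0 :
  P i0 -> (forall i, P i -> i = i0) -> \sum_i F i * (P i)%:R = F i0.
Proof.
move=> Pi0 uniqP; rewrite (bigD1 i0) //= Pi0 mulr1 big1 ?addr0 // => i ne_i.
by case: (boolP (P i)) => [/uniqP e|_]; [rewrite e eqxx in ne_i | rewrite mulr0].
Qed.

(** This is $s_{m+1}(t)$. Summing over pairs of cells avoids choosing the cells of the two values;
    on a tableau a single pair contributes. *)
Definition step m t : int :=
  \sum_(q : cell la * cell la) adj q.1 q.2 *
    ((t q.1 == m :> nat) && (t q.2 == m.+1 :> nat))%:R.

Lemma stepE m t x y : t \in rSYT la -> t x = m :> nat -> t y = m.+1 :> nat ->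
  step m t = adj x y.
Proof.
move=> tS tx ty; have [t_inj _ _ _] := rSYTP tS.
rewrite /step (sum_unique (fun q => adj q.1 q.2) (i0 := (x, y))) //= ?tx ?ty ?eqxx //.
move=> [u v] /= /andP[/eqP tu /eqP tv].
by congr (_, _); apply/t_inj/ord_inj; rewrite ?tu ?tv.
Qed.

(** Double counting of pairs of a tableau and a triple of cells. *)
Lemma sum_triple m (F : cell la -> cell la -> cell la -> int) :
  \sum_p F p.1.1 p.1.2 p.2 * #|triple m p.1.1 p.1.2 p.2|%:R =
  \sum_(t in rSYT la) \sum_p F p.1.1 p.1.2 p.2 * (t \in triple m p.1.1 p.1.2 p.2)%:R.
Proof.
rewrite exchange_big /=; apply: eq_bigr => p _.
rewrite -mulr_sumr; congr (_ * _).
rewrite -sum1_card natr_sum big_mkcond [RHS]big_mkcond /=.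
apply: eq_bigr => t _; case: (boolP (t \in triple _ _ _ _)) => [/tripleP[-> _ _ _] //|_].
by case: ifP.
Qed.

Local Close Scope ring_scope.

(** * Invariance of the triple counts under swaps *)

Hypothesis la_part : is_partition la.

(* Consecutive entries in a common row or column lie in neighbouring cells,
   so the swap can only violate monotonicity at a pair with [adj x y != 0]. *)
Lemma rSYT_swap t x y (i j : 'I_(sumn la)) : t \in rSYT la -> val j = i.+1 ->
  t x = i -> t y = j -> adj x y = 0%R -> swap i j t \in rSYT la.
Proof.
move=> tS ij tx ty nadj; have [t_inj t_surj t_row t_col] := rSYTP tS.
have t_ne u v : t u = i -> t v = j -> u = x /\ v = y.
  by rewrite -tx -ty => /t_inj-> /t_inj->.
apply: rSYT_mem => [u v|k|u v e l|u v e l].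
- by rewrite !ffunE => /perm_inj/t_inj.
- by have [u tu] := t_surj (tperm i j k); exists u; rewrite ffunE tu tpermK.
- rewrite !ffunE; apply: tperm_succ_mono; rewrite ?t_row // => tu tv.
  have [? ?] := t_ne _ _ tu tv; subst u v.
  have [c1|c1] := eqVneq (cell_col y) (cell_col x).+1.
    by move: nadj; rewrite /adj; repeat case: ifP => ?; lia.
  have [w [rw cw]] : exists w : cell la,
      cell_row w = cell_row x /\ cell_col w = (cell_col x).+1.
    by apply: cell_ex; move: (cellP x) (cellP y); rewrite /in_diagram; lia.
  have xw : t x < t w by apply: t_row; lia.
  have wy : t w < t y by apply: t_row; lia.
  by move: xw wy ij; rewrite tx ty /=; lia.
- rewrite !ffunE; apply: tperm_succ_mono; rewrite ?t_col // => tu tv.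
  have [? ?] := t_ne _ _ tu tv; subst u v.
  have [c1|c1] := eqVneq (cell_row y) (cell_row x).+1.
    by move: nadj; rewrite /adj; repeat case: ifP => ?; lia.
  (* Rows do not get longer downwards, so a column reaching the row of [y] has no gap below [x]. *)
  have [w [rw cw]] : exists w : cell la,
      cell_row w = (cell_row x).+1 /\ cell_col w = cell_col x.
    apply: cell_ex; move: (cellP x) (cellP y) => xd yd.
    have := @partition_nth la (cell_row x).+1 (cell_row y) la_part.
    by move: xd yd; rewrite /in_diagram; lia.
  have xw : t x < t w by apply: t_col; lia.
  have wy : t w < t y by apply: t_col; lia.
  by move: xw wy ij; rewrite tx ty /=; lia.
Qed.

Lemma card_triple_swap12_le m x y z : adj x y = 0%R ->
  #|triple m x y z| <= #|triple m y x z|.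
Proof.
(* A member [t0] bounds [m.+2], so that the swapped values exist as ordinals. *)
move=> nadj; have [->|[t0 /tripleP[_ _ ty0 tz0]]] := set_0Vmem (triple m x y z).
  by rewrite cards0.
have lt_m : m.+2 < sumn la by rewrite -tz0.
pose i := Ordinal (ltnW (ltnW lt_m)); pose j := Ordinal (ltnW lt_m).
rewrite -(card_imset _ (inv_inj (swapK i j))); apply/subset_leq_card/subsetP.
move=> _ /imsetP[t /tripleP[tS tx ty tz] ->].
have ex : t x = i by apply: val_inj.
have ey : t y = j by apply: val_inj.
apply/tripleP; split; first exact: (rSYT_swap tS _ ex ey).
- by rewrite ffunE ey tpermR.
- by rewrite ffunE ex tpermL.
- by rewrite ffunE tpermD // -val_eqE /= tz; lia.
Qed.

Lemma card_triple_swap23_le m x y z : adj y z = 0%R ->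
  #|triple m x y z| <= #|triple m x z y|.
Proof.
move=> nadj; have [->|[t0 /tripleP[_ _ ty0 tz0]]] := set_0Vmem (triple m x y z).
  by rewrite cards0.
have lt_m : m.+2 < sumn la by rewrite -tz0.
pose i := Ordinal (ltnW lt_m); pose j := Ordinal lt_m.
rewrite -(card_imset _ (inv_inj (swapK i j))); apply/subset_leq_card/subsetP.
move=> _ /imsetP[t /tripleP[tS tx ty tz] ->].
have ey : t y = i by apply: val_inj.
have ez : t z = j by apply: val_inj.
apply/tripleP; split; first exact: (rSYT_swap tS _ ey ez).
- by rewrite ffunE tpermD // -val_eqE /= tx; lia.
- by rewrite ffunE ez tpermR.
- by rewrite ffunE ey tpermL.
Qed.

Lemma card_triple_swap12 m x y z : adj x y = 0%R ->
  #|triple m x y z| = #|triple m y x z|.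
Proof.
by move=> xy; apply/eqP; rewrite eqn_leq !card_triple_swap12_le // adjC.
Qed.

Lemma card_triple_swap23 m x y z : adj y z = 0%R ->
  #|triple m x y z| = #|triple m x z y|.
Proof.
by move=> yz; apply/eqP; rewrite eqn_leq !card_triple_swap23_le // adjC.
Qed.

(** * The change of sign from one position to the next *)

Local Open Scope ring_scope.

(* [iso_l], [iso_r]: the third cell is incomparable to both cells of the cover,
   and swapping twice moves it across. [lower], [upper]: one cell has two lower
   (upper) covers, one vertical and one horizontal, which the swap exchanges. *)
Lemma hook_sum m :
  \sum_p (adj p.1.2 p.2 - adj p.1.1 p.1.2) * #|triple m p.1.1 p.1.2 p.2|%:R =
  2 * \sum_p (hook p.1.1 p.1.2 p.2)%:R * #|triple m p.1.1 p.1.2 p.2|%:R :> int.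
Proof.
pose N (p : cell la * cell la * cell la) : int := #|triple m p.1.1 p.1.2 p.2|%:R.
have N_neq0 p : N p != 0 -> exists t, t \in triple m p.1.1 p.1.2 p.2.
  by rewrite /N => nz; apply/card_gt0P; lia.
pose iso_l p :=
    ((adj p.1.1 p.1.2 == 0) && (adj p.1.1 p.2 == 0))%:R * adj p.1.2 p.2 * N p.
pose iso_r p :=
    ((adj p.1.2 p.2 == 0) && (adj p.1.1 p.2 == 0))%:R * adj p.1.1 p.1.2 * N p.
pose lower p :=
    ((adj p.1.1 p.1.2 == 0) && (adj p.1.1 p.2 != 0))%:R * adj p.1.2 p.2 * N p.
pose upper p :=
    ((adj p.1.2 p.2 == 0) && (adj p.1.1 p.2 != 0))%:R * adj p.1.1 p.1.2 * N p.
(* The identity holds term by term. Chains are settled by [adj_chain]; if just one of the two signs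
   vanishes, [adj x z] decides which of the four remaining terms is present; if both vanish, so does
   every term. *)
have -> : \sum_p (adj p.1.2 p.2 - adj p.1.1 p.1.2) * N p =
    \sum_p (2 * ((hook p.1.1 p.1.2 p.2)%:R * N p) + (iso_l p - iso_r p + (lower p - upper p))).
  apply: eq_bigr => -[[x y] z] _; rewrite /iso_l /iso_r /lower /upper /=.
  have [->|/N_neq0[/= t tP]] := eqVneq (N (x, y, z)) 0; first by rewrite !mulr0 !subr0.
  have := adj_chain tP; have := @hook_adj x y z;
  case: (hook x y z) => [/(_ isT)[-> ->]|_]; first by rewrite /=; lia.
  case: (eqVneq (adj x y) 0) => [->|xy]; case: (eqVneq (adj y z) 0) => [->|yz];
    case: (eqVneq (adj x z) 0) => xz /= chain; try lia.
rewrite big_split /= -mulr_sumr big_split /= !sumrB.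
have -> : \sum_p iso_l p = \sum_p iso_r p.
  (* The rotation brings the incomparable cell from the last place to the first. *)
  rewrite (reindex_inj (h := fun p : cell la * cell la * cell la =>
    (p.2, p.1.1, p.1.2))); last first.
    by move=> [[a b] c] [[d e] f] /= [-> -> ->].
  apply: eq_bigr => -[[x y] z] _; rewrite /iso_l /iso_r /= ![adj z _]adjC andbC.
  case: eqP => [yz|]; last by rewrite /= !mul0r.
  case: eqP => [xz|]; last by rewrite /= !mul0r.
  by congr (_ * _); rewrite /N /= card_triple_swap12 1?adjC // (card_triple_swap23 _ _ yz).
have eq_opp0 (a : int) : a = - a -> a = 0 by lia.
have -> : \sum_p lower p = 0.
  (* Exchanging the first two cells keeps [N] and, by [adj_lower], negates the sign, so the sum is
     its own opposite. *)
  apply: eq_opp0.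
  rewrite {1}(reindex_inj (h := fun p : cell la * cell la * cell la =>
    (p.1.2, p.1.1, p.2))); last first.
    by move=> [[a b] c] [[d e] f] /= [-> -> ->].
  rewrite -sumrN; apply: eq_bigr => -[[x y] z] _; rewrite /lower /= [adj y x]adjC.
  case: eqP => [xy|]; last by rewrite /= !mul0r oppr0.
  have -> : N (y, x, z) = N (x, y, z) by rewrite /N /= card_triple_swap12 1?adjC.
  have [->|/N_neq0[/= t tP]] := eqVneq (N (x, y, z)) 0; first by rewrite !mulr0 oppr0.
  have := adj_lower tP; case: (eqVneq (adj x z) 0) => [->|xz];
    case: (eqVneq (adj y z) 0) => [->|yz] //= opp; try lia.
have -> : \sum_p upper p = 0.
  apply: eq_opp0.
  rewrite {1}(reindex_inj (h := fun p : cell la * cell la * cell la =>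
    (p.1.1, p.2, p.1.2))); last first.
    by move=> [[a b] c] [[d e] f] /= [-> -> ->].
  rewrite -sumrN; apply: eq_bigr => -[[x y] z] _; rewrite /upper /= [adj z y]adjC.
  case: eqP => [yz|]; last by rewrite /= !mul0r oppr0.
  have -> : N (x, z, y) = N (x, y, z) by rewrite /N /= (card_triple_swap23 _ _ yz).
  have [->|/N_neq0[/= t tP]] := eqVneq (N (x, y, z)) 0; first by rewrite !mulr0 oppr0.
  have := adj_upper tP; case: (eqVneq (adj x z) 0) => [->|xz];
    case: (eqVneq (adj x y) 0) => [->|xy] //= opp; try lia.
by rewrite !subrr !addr0.
Qed.

(** Each tableau lies in [triple m x y z] for exactly one triple of cells, so both sides of
    [hook_sum] collapse to one term per tableau. The middle value [m.+1] is the entry [m.+2]. *)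
Lemma sum_step m : (m.+2 < sumn la)%N ->
  \sum_(t in rSYT la) (step m.+1 t - step m t) =
  2 * \sum_(t in rSYT la) (braid_hook t m.+2)%:R.
Proof.
move=> lt_m; have := hook_sum m.
rewrite (sum_triple _ (fun x y z => adj y z - adj x y))
  (sum_triple _ (fun x y z => (hook x y z)%:R)).
have triple_ex t : t \in rSYT la -> exists x y z, t \in triple m x y z.
  move=> tS; have [x tx] := rSYT_ex tS (ltnW (ltnW lt_m)).
  have [y ty] := rSYT_ex tS (ltnW lt_m); have [z tz] := rSYT_ex tS lt_m.
  by exists x, y, z; apply/tripleP.
have sumE t x y z (F : cell la -> cell la -> cell la -> int) : t \in triple m x y z ->
    \sum_p F p.1.1 p.1.2 p.2 * (t \in triple m p.1.1 p.1.2 p.2)%:R = F x y z.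
  move=> tP; rewrite (sum_unique (fun p => F p.1.1 p.1.2 p.2) (i0 := (x, y, z))) //.
  move: tP => /tripleP[tS tx ty tz]; have [t_inj _ _ _] := rSYTP tS.
  move=> [[u v] w] /tripleP[_ /= tu tv tw].
  by congr (_, _, _); apply/t_inj/ord_inj; rewrite ?tu ?tv ?tw.
move=> E; transitivity (\sum_(t in rSYT la)
    \sum_p (adj p.1.2 p.2 - adj p.1.1 p.1.2) * (t \in triple m p.1.1 p.1.2 p.2)%:R).
  apply: eq_bigr => t tS; have [x [y [z tP]]] := triple_ex t tS.
  rewrite (sumE _ _ _ _ (fun x y z => adj y z - adj x y) tP).
  by have [_ tx ty tz] := tripleP _ _ _ _ _ tP; rewrite (stepE tS ty tz) (stepE tS tx ty).
rewrite E; congr (_ * _); apply: eq_bigr => t tS; have [x [y [z tP]]] := triple_ex t tS.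
rewrite (sumE _ _ _ _ (fun x y z => (hook x y z)%:R) tP); congr (_%:R); congr (nat_of_bool _).
have [_ tx ty tz] := tripleP _ _ _ _ _ tP.
apply/idP/existsP => [xyz|[u /existsP[v /existsP[w]]]].
  exists x; apply/existsP; exists y; apply/existsP; exists z.
  by case/and3P: xyz => -> -> ->; rewrite /entry tx ty tz !eqxx.
case/and4P=> r1 r2 r3; rewrite /entry !eqSS => /and3P[/eqP tu /eqP tv /eqP tw].
have [t_inj _ _ _] := rSYTP tS.
have -> : x = u by apply/t_inj/ord_inj; rewrite tx tu.
have -> : y = v by apply/t_inj/ord_inj; rewrite ty tv.
have -> : z = w by apply/t_inj/ord_inj; rewrite tz tw.
by rewrite /hook r1 r2.
Qed.

(** * The two ends of the telescoping sum *)

Lemma step_first t : (2 <= size la)%N -> (nth 0 la 1 < nth 0 la 0)%N ->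
  (1 < sumn la)%N -> t \in rSYT la -> step 0 t = -1.
Proof.
move=> la_size la_12 lt1 tS.
have [x tx] := rSYT_ex tS (ltnW lt1); have [y ty] := rSYT_ex tS lt1.
have [x0 [r0 c0]] : exists u : cell la, cell_row u = 0%N /\ cell_col u = 0%N.
  by apply: cell_ex; rewrite /in_diagram; lia.
have ex : x = x0.
  by apply/eqP/negPn/negP => /eqP/nesym ne; have := rSYT_lt tS _ _ ne; lia. subst x0.
have yx : y <> x by move=> e; subst; lia.
have [w [rw cw]] : exists u : cell la, cell_row u = 0%N /\ cell_col u = 1%N.
  by apply: cell_ex; have := partition_nth la_part (leqnn 1) la_size; rewrite /in_diagram; lia.
(* All lower rows are shorter than the first, so column 0 has only its top cell, which holds the
   entry 1. *)
have cy : cell_col y <> 0%N.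
  move=> cy; apply: yx; apply: cell_eq; last lia.
  have := cellP y; have := @partition_nth la 1 (cell_row y) la_part.
  by rewrite /in_diagram; lia.
(* Every cell outside column 0 is weakly below and to the right of [w]. *)
have ey : y = w.
  apply/eqP/negPn/negP => /eqP/nesym ne; have := rSYT_lt tS _ _ ne.
  have : x <> w by move=> e; subst w; lia.
  by move/(rSYT_lt tS); lia.
by rewrite (stepE tS tx ty) /adj; subst y; rewrite r0 c0 rw cw.
Qed.

(** The largest entry sits in the bottom right cell, alone in its row. All other cells are weakly
    above and to the left of the cell just above it, which therefore holds the second largest
    entry. *)
Lemma step_last t n : (2 <= size la)%N -> last 0%N la = 1%N ->
  sumn la = n.+2 -> t \in rSYT la -> step n t = 1.
Proof.
move=> la_size la_last la_n tS.
have [x tx] : exists x, t x = n :> nat by apply: rSYT_ex tS _; lia.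
have [y ty] : exists y, t y = n.+1 :> nat by apply: rSYT_ex tS _; lia.
have nth_last : nth 0%N la (size la).-1 = 1%N by rewrite nth_last.
have la_pos r : (r < size la)%N -> (0 < nth 0%N la r <= nth 0%N la 0)%N
  by apply: partition_nth.
have t_le u : (t u <= n.+1)%N by have := ltn_ord (t u); lia.
have [y0 [r0 c0]] : exists u : cell la,
    cell_row u = (size la).-1 /\ cell_col u = (nth 0%N la 0).-1.
  by apply: cell_ex; have := la_pos (size la).-1; rewrite /in_diagram; lia.
have le_last (u : cell la) : (cell_row u <= (size la).-1)%N /\
    (cell_col u <= (nth 0%N la 0).-1)%N.
  by have := cellP u; rewrite /in_diagram; lia.
have ey : y = y0.
  apply/eqP/negPn/negP => /eqP ne; have := rSYT_lt tS _ _ ne.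
  by have := le_last y; have := t_le y0; lia.
subst y0.
have xy : x <> y by move=> e; subst; lia.
have rx : cell_row x <> (size la).-1.
  move=> rx; apply: xy; apply: cell_eq; first lia.
  by have := cellP x; rewrite /in_diagram rx nth_last; lia.
have [w [rw cw]] : exists u : cell la,
    cell_row u = (size la).-2 /\ cell_col u = (nth 0%N la 0).-1.
  by apply: cell_ex; have := la_pos (size la).-2; rewrite /in_diagram; lia.
have ex : x = w.
  apply/eqP/negPn/negP => /eqP ne; have := rSYT_lt tS _ _ ne.
  have : w <> y by move=> e; subst w; lia.
  by move/(rSYT_lt tS); have := le_last x; have := t_le w; lia.
rewrite (stepE tS tx ty) /adj; subst w; rewrite r0 c0 rw cw.
by repeat case: ifP => ?; lia.
Qed.

End Tableaux.
End Cells.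

(** * Telescoping and the average *)

Local Open Scope ring_scope.

Theorem theorem3p2 (la : seq nat)
  (la_part : is_partition la)
  (la_size : (2 <= size la)%N)
  (la_12 : (nth 0%N la 1 < nth 0%N la 0)%N)
  (la_last : last 0%N la = 1%N) :
  (\sum_(t in rSYT la) (num_braid_hooks t)%:R) / (#|rSYT la|)%:R = 1 :> rat.
Proof.
have [n la_n] : exists n, sumn la = n.+2.
  have sum_ge : (2 <= sumn la)%N.
    have := partition_nth la_part (leqnn 1) la_size.
    by case: la la_size la_12 {la_part la_last} => [|a [|b s]] //=; lia.
  by exists (sumn la - 2)%N; lia.
suff sum_num : (\sum_(t in rSYT la) num_braid_hooks t)%N = #|rSYT la|.
  by rewrite -natr_sum sum_num divff // pnatr_eq0 -lt0n rSYT_neq0.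
have : \sum_(t in rSYT la) (step n t - step 0 t) =
    2 * \sum_(t in rSYT la) (num_braid_hooks t)%:R.
  under eq_bigr => t _ do rewrite -(telescope_sumr (fun m => step m t)) //.
  rewrite exchange_big /= big_nat.
  under eq_bigr => m lt_m do rewrite (sum_step la_part) ?la_n ?ltnS //.
  rewrite -big_nat -mulr_sumr exchange_big /=; congr (_ * _).
  by apply: eq_bigr => t _; rewrite (num_braid_hooksE _ la_n) natr_sum.
(* Every tableau contributes $1-(-1)=2$, which cancels the factor 2 on the right. *)
rewrite (eq_bigr (fun=> 2)); last first.
  move=> t tS; rewrite (step_last la_part la_size la_last la_n tS).
  by rewrite (step_first la_part la_size la_12 _ tS) ?la_n.
by rewrite sumr_const -natr_sum; lia.
Qed.
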